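(* Assume that continuous functions are dense in $N^1X(\mathcal P)$ (i.e. for every $u\in N^1X(\mathcal P)$ and $\varepsilon>0$ there is a continuous $v\in N^1X(\mathcal P)$ with $\|u-v\|_{N^1X}<\varepsilon$). Then properties (A), (B), (C), (D), (E) are all equivalent, and (F) and (G) hold. Moreover, there exist a compact metric space $\mathcal P$ (satisfying the standing assumptions) and a Banach function lattice $X$ such that continuous functions are dense in $N^1X(\mathcal P)$ but (A)–(E) all fail.
   Context: Standing assumptions: $\mathcal P=(\mathcal P,d,\mu)$ is a metric space with a positive complete Borel measure $\mu$ such that $0<\mu(B)<\infty$ for every ball $B$; $\mu$ is extended as an outer measure to all subsets. $\overline{\mathbf R}=[-\infty,\infty]$. A quasi-Banach function lattice $X=X(\mathcal P)$ is a vector space of extended real-valued measurable functions defined everywhere on $\mathcal P$ with a functional $\|\cdot\|_X$ such that: $X=\{u:\|u\|_X<\infty\}$; $\|u\|_X=0$ iff $u=0$ a.e., $\|au\|_X=|a|\|u\|_X$, and $\|u+v\|_X\le c_\wedge(\|u\|_X+\|v\|_X)$ for some $c_\wedge\ge1$; $|u|\le|v|$ a.e. implies $\|u\|_X\le\|v\|_X$; and if $u_n\ge0$ a.e. then $\|\sum_{n\ge1}u_n\|_X\le\sum_{n\ge1}c_\wedge^n\|u_n\|_X$. The quasinorm is assumed continuous: $\|u_n-u\|_X\to0$ implies $\|u_n\|_X\to\|u\|_X$. If $c_\wedge=1$, $X$ is a Banach function lattice. A Borel $g:\mathcal P\to[0,\infty]$ is an upper gradient of $u:\mathcal P\to\overline{\mathbf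 R}$ if $|u(\gamma(0))-u(\gamma(l_\gamma))|\le\int_\gamma g\,ds$ for every nonconstant rectifiable (arc-length parametrized) curve $\gamma:[0,l_\gamma]\to\mathcal P$. $N^1X(\mathcal P)=\{u\in X:\|u\|_{N^1X}:=\|u\|_X+\inf_g\|g\|_X<\infty\}$, infimum over upper gradients. $C_X(E)=\inf\{\|u\|_{N^1X}:u\in N^1X,\ u\ge1\text{ on }E\}$; ''q.e.'' means outside a set of zero capacity. $C_X$ is a $c$-quasiouter capacity ($c\ge1$) if $\inf\{C_X(G):G\supset E\text{ open}\}\le cC_X(E)$ for all $E$; quasiouter if this holds for some $c$; outer if with $c=1$; outer for sets of zero capacity if whenever $C_X(E)=0$ and $\varepsilon>0$ there is open $G\supset E$ with $C_X(G)<\varepsilon$. $u:\mathcal P\to\overline{\mathbf R}$ is weakly quasicontinuous if for every $\varepsilon>0$ there is $E$ with $C_X(E)<\varepsilon$ and $u|_{\mathcal P\setminus E}$ (real-valued) continuous; quasicontinuous if $E$ can be chosen open. Properties: (A) every $u\in N^1X(\mathcal P)$ is quasicontinuous; (B) $C_X$ is outer; (C) $C_X$ is quasiouter; (D) every weakly quasicontinuous $u:\mathcal P\to\overline{\mathbf R}$ is quasicontinuous; (E) $C_X$ is outer for sets of zero capacity; (F) every $u\in N^1X(\mathcal P)$ has a quasicontinuous $v$ with $v=u$ q.e.; (G) every $u\in N^1X(\mathcal P)$ is weakly quasicontinuous. *)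

(* Defs.v *)
From HB Require Import structures.
From mathcomp Require Import all_boot all_order all_algebra.
From mathcomp Require Import all_classical all_reals all_analysis measurable_realfun.
Set Implicit Arguments. Unset Strict Implicit. Unset Printing Implicit Defensive.
Import Order.TTheory GRing.Theory Num.Theory.
Local Open Scope classical_set_scope.
Local Open Scope ring_scope.

Section Setting.
Context {R : realType} {d0 : measure_display} {T : measurableType d0}.

Variable dist : T -> T -> R.

Definition is_metric : Prop :=
  (forall x y, 0 <= dist x y) /\ (forall x y, dist x y = 0 <-> x = y) /\
  (forall x y, dist x y = dist y x) /\
  (forall x y z, dist x z <= dist x y + dist y z).

Definition mball (x : T) (r : R) : set T := [set y | dist x y < r].

Definition mopen (G : set T) : Prop :=
  forall x, G x -> exists2 r : R, 0 < r & mball x r `<=` G.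

Definition borel_sets : set (set T) := <<s mopen >>.

Definition metric_compact : Prop :=
  forall (I : Type) (G : I -> set T), (forall i, mopen (G i)) ->
    (forall x, exists i, G i x) ->
    exists (n : nat) (f : nat -> I), forall x, exists2 k, (k < n)%N & G (f k) x.

Definition curve_length (gam : R -> T) (s t : R) : \bar R :=
  ereal_sup [set L | exists (n : nat) (p : nat -> R),
    [/\ p 0%N = s, p n = t, (forall i, (i < n)%N -> p i <= p i.+1) &
        L = (\sum_(i < n) (dist (gam (p i)) (gam (p i.+1)))%:E)%E]].

(* gam : [0,l] -> T is a nonconstant rectifiable curve parametrized by
   arc length (only the values on [0,l] are relevant) *)
Definition arclength_curve (gam : R -> T) (l : R) : Prop :=
  0 < l /\ forall s t, 0 <= s -> s <= t -> t <= l ->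
    curve_length gam s t = (t - s)%:E.

Definition borel_fun (g : T -> \bar R) : Prop :=
  forall B : set (\bar R), measurable B -> borel_sets (g @^-1` B).

Definition upper_gradient (u g : T -> \bar R) : Prop :=
  borel_fun g /\ (forall x, 0 <= g x)%E /\
  forall (gam : R -> T) (l : R), arclength_curve gam l ->
    (`|u (gam 0%R) - u (gam l)| <=
       \int[@lebesgue_measure R]_(t in `[0%R, l]) g (gam t))%E.

Variable mu : {measure set T -> \bar R}.

Definition standing_assumptions : Prop :=
  [/\ is_metric, (forall G, mopen G -> measurable G),
      measure_is_complete mu &
      (forall x (r : R), 0 < r -> (0 < mu (mball x r))%E /\ (mu (mball x r) < +oo)%E)].

Definition outer_mu (E : set T) : \bar R :=
  ereal_inf [set mu A | A in [set A | measurable A /\ E `<=` A]].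

Definition ae (P : T -> Prop) : Prop := outer_mu [set x | ~ P x] = 0%E.

Variable N : (T -> \bar R) -> \bar R.

Definition mfun (u : T -> \bar R) : Prop := measurable_fun setT u.

Definition inX (u : T -> \bar R) : Prop := mfun u /\ (N u < +oo)%E.

(* X is a quasi-Banach function lattice with constant c (c = 1: Banach
   function lattice), with continuous quasinorm *)
Definition qBFL (c : R) : Prop :=
  [/\ 1 <= c,
   (forall u, mfun u -> 0 <= N u)%E,
   (forall u, mfun u -> (N u = 0%E <-> ae (fun x => u x = 0%E))),
   (forall (a : R) u, mfun u -> N (fun x => a%:E * u x)%E = (`|a|%:E * N u)%E) &
  [/\ (forall u v, mfun u -> mfun v ->
      N (fun x => u x + v x)%E <= c%:E * (N u + N v))%E,
   (forall u v, mfun u -> mfun v -> ae (fun x => `|u x| <= `|v x|)%E ->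
      (N u <= N v)%E),
   (forall un : nat -> T -> \bar R, (forall n, mfun (un n)) ->
      (forall n, ae (fun x => 0 <= un n x)%E) ->
      (N (fun x => \sum_(0 <= n <oo) un n x) <=
         \sum_(0 <= n <oo) (c ^+ n.+1)%:E * N (un n))%E) &
   (forall (un : nat -> T -> \bar R) u, (forall n, inX (un n)) -> inX u ->
      (fun n => N (fun x => un n x - u x)%E) @ \oo --> 0%E ->
      (fun n => N (un n)) @ \oo --> N u)]].

Definition N1norm (u : T -> \bar R) : \bar R :=
  (N u + ereal_inf [set N g | g in upper_gradient u])%E.

Definition inN1X (u : T -> \bar R) : Prop := inX u /\ (N1norm u < +oo)%E.

Definition cap (E : set T) : \bar R :=
  ereal_inf [set N1norm u | u in
             [set u | inN1X u /\ forall x, E x -> (1 <= u x)%E]].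

Definition qe (P : T -> Prop) : Prop :=
  exists E, cap E = 0%E /\ forall x, ~ E x -> P x.

Definition cont_off (u : T -> \bar R) (E : set T) : Prop :=
  (forall x, ~ E x -> u x \is a fin_num) /\
  forall x, ~ E x -> forall eps : R, 0 < eps -> exists2 del : R, 0 < del &
    forall y, ~ E y -> dist x y < del -> `|fine (u y) - fine (u x)| < eps.

Definition weakly_quasicontinuous (u : T -> \bar R) : Prop :=
  forall eps : R, 0 < eps -> exists E, (cap E < eps%:E)%E /\ cont_off u E.

Definition quasicontinuous (u : T -> \bar R) : Prop :=
  forall eps : R, 0 < eps ->
    exists E, [/\ mopen E, (cap E < eps%:E)%E & cont_off u E].

Definition quasiouter (c : R) : Prop :=
  forall E, (ereal_inf [set cap G | G in [set G | mopen G /\ E `<=` G]]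
             <= c%:E * cap E)%E.

Definition propertyA : Prop := forall u, inN1X u -> quasicontinuous u.
Definition propertyB : Prop := quasiouter 1.
Definition propertyC : Prop := exists c : R, 1 <= c /\ quasiouter c.
Definition propertyD : Prop := forall u : T -> \bar R,
  weakly_quasicontinuous u -> quasicontinuous u.
Definition propertyE : Prop := forall E, cap E = 0%E ->
  forall eps : R, 0 < eps -> exists G, [/\ mopen G, E `<=` G & (cap G < eps%:E)%E].
Definition propertyF : Prop := forall u, inN1X u ->
  exists v, quasicontinuous v /\ qe (fun x => v x = u x).
Definition propertyG : Prop := forall u, inN1X u -> weakly_quasicontinuous u.

Definition cont_dense : Prop :=
  forall u, inN1X u -> forall eps : R, 0 < eps ->
    exists v, [/\ inN1X v, cont_off v set0 &
                 (N1norm (fun x => u x - v x)%E < eps%:E)%E].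

End Setting.

(* Main.v *)
Require Import Defs.
From mathcomp Require Import all_boot all_order all_algebra.
From mathcomp Require Import all_classical all_reals all_analysis measurable_realfun.
From mathcomp Require Import ring lra.
Set Implicit Arguments. Unset Strict Implicit. Unset Printing Implicit Defensive.
Import Order.TTheory GRing.Theory Num.Theory numFieldNormedType.Exports.
Local Open Scope classical_set_scope.
Local Open Scope ring_scope.

(** The implications (B) => (C) => (D), (E) are immediate. Given [u] in [N^1X],
    take continuous [w_k] with [N1norm (u - w_k)] decaying geometrically; off the
    small sets [U_{k >= j} {|u - w_k| >= 2^-k}] the [w_k] converge uniformly to [u],
    which is (G), so (D) => (A). These sets contain the open sets
    [U_{k >= j} {|w_{k+1} - w_k| > 2 2^-k}], off which [w_k] still converges
    uniformly, to a function [v] that is therefore quasicontinuous: this is (F), and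
    enlarging the exceptional set by an open neighbourhood of the null set
    [{u <> v}] gives (E) => (A). For (A) => (B), if [u >= 1] on [E] nearly realizes
    [cap E] and is continuous off the open set [G_n] of capacity [< 1/n], then
    [G_n U {(1 + 1/n) u > 1}] is an open neighbourhood of [E], and the capacity of
    that is controlled by the continuity of the quasinorm.

    For the counterexample, take the compact set [{0} U {1/n : n >= 1}] with an
    ultrametric (so that there are no rectifiable curves, and [N^1X = X]), a finite
    measure charging exactly the points [1/n], and [X] the unweighted [l^1] space on
    these points. Finitely supported functions are dense, [{0}] has capacity zero,
    but any neighbourhood of [0] has infinite capacity. *)

(** * Truncation and Lipschitz estimates on the extended reals *)

Section ExtendedReals.
Context {R : realType}.
Implicit Types a b : \bar R.

(** A 1-Lipschitz truncation to [0, 1]: it lets capacity test functions be taken finite, so that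
    their sums and differences cause no trouble. *)
Definition trunc1 a : \bar R := mine 1%E `|a|%E.

Lemma trunc1_bounds a : (0 <= trunc1 a <= 1)%E.
Proof. by rewrite /trunc1 le_min ge_min lee01 abse_ge0 lexx. Qed.

Lemma trunc1_le a : (`|trunc1 a| <= 1%:E * `|a|)%E.
Proof.
have /andP[t0 _] := trunc1_bounds a.
by rewrite gee0_abs// mul1e ge_min lexx orbT.
Qed.

(** As soon as one argument is infinite, [|a - b|] is [+oo], even for [+oo - +oo], which is [-oo] by
    convention; only finite arguments need a computation. *)
Lemma trunc1_lip a b : (`|trunc1 a - trunc1 b| <= 1%:E * `|a - b|)%E.
Proof.
rewrite mul1e; case: a b => [a| |] [b| |] //; rewrite ?leey//.
rewrite /trunc1 /= -!EFin_min /= lee_fin.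
have := ler_dist_dist a b; rewrite !ler_norml !minEle.
by do 2! case: ifPn; rewrite -?ltNge; lra.
Qed.

Lemma abse_scale_lip (k : R) a b : 0 < k ->
  (`| `|k%:E * a| - `|k%:E * b| | <= k%:E * `|a - b|)%E.
Proof.
move=> k0.
case: a b => [a| |] [b| |] /=; rewrite -?EFinB ?gt0_mulye ?gt0_mulNye ?lte_fin//= ?gt0_muley ?lte_fin// ?leey//.
rewrite lee_fin -[X in X * `|_|](gtr0_norm k0) -normrM mulrBr.
exact: ler_dist_dist.
Qed.

Lemma inv_exp2_small (eps : R) : 0 < eps -> exists n, 2 ^- n < eps.
Proof.
move=> e0; exists (Num.truncn eps^-1).
rewrite -[ltRHS]invrK ltf_pV2 ?posrE ?exprn_gt0 ?invr_gt0//.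
apply: lt_le_trans (truncnS_gt _) _; rewrite -natrX ler_nat; exact: ltn_expl.
Qed.

(** Meant for a curve integral [r] that may be infinite: it leaves only finite [r], where real
    arithmetic is available. *)
Lemma abse_EFin_sub_le (r : \bar R) (a b : R) :
  (forall k : R, r = k%:E -> a - b <= k /\ b - a <= k) -> (0 <= r)%E -> (`|a%:E - b%:E| <= r)%E.
Proof.
move=> H r0; case: r r0 H => [r||]//= _ H; last by rewrite leey.
have [? ?] := H _ erefl.
by rewrite lee_fin ler_norml lerNl opprB; apply/andP.
Qed.

Lemma fin_num_near (a b : \bar R) (r : R) : b \is a fin_num ->
  (`|a - b| <= r%:E)%E -> a \is a fin_num /\ `|fine a - fine b| <= r.
Proof. by case: a b => [a| |] [b| |]. Qed.

End ExtendedReals.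

(** * Upper gradients *)

Section Curves.
Context {R : realType} {d0 : measure_display} {T : measurableType d0}.
Variable dist : T -> T -> R.
Hypothesis dist_metric : is_metric dist.

(** The partition of [[s, t]] by its two endpoints already bounds the length from below. *)
Lemma arclength_curve_lip gam l : arclength_curve dist gam l ->
  forall s t, 0 <= s -> s <= t -> t <= l -> dist (gam s) (gam t) <= t - s.
Proof.
move=> [_ lenE] s t s0 st tl; rewrite -lee_fin -(lenE _ _ s0 st tl).
apply: ereal_sup_ubound; exists 1%N, (fun i => if i is 0%N then s else t).
by split=> //; [case | rewrite big_ord1].
Qed.

(** Borel sets of the metric need not exhaust the sigma-algebra of [T]; on the generated type the
    usual closure lemmas for measurable functions apply. *)
Lemma borel_funE (g : T -> \bar R) : borel_fun dist g <->
  measurable_fun setT (g : g_sigma_algebraType (mopen dist) -> \bar R).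
Proof.
split=> [mg _ B mB|mg B mB]; first by rewrite setTI; exact: mg.
by have := mg measurableT B mB; rewrite setTI.
Qed.

Lemma arclength_curve_measurable gam l : arclength_curve dist gam l ->
  measurable_fun (`[0, l]%classic : set R)
    (gam : R -> g_sigma_algebraType (mopen dist)).
Proof.
move=> hg; have [_ [_ [dC _]]] := dist_metric.
apply: (@measurability _ _ R (g_sigma_algebraType (mopen dist)) _ _
  (mopen dist)) => // _ [G oG <-].
(* [W] is an open set of parameters with the same trace on [[0, l]] as the preimage of [G]; the
   inclusion of [W] in the preimage uses that [gam] is 1-Lipschitz. *)
pose W := \bigcup_(p in [set p : R * R | [/\ 0 <= p.1 <= l, 0 < p.2 &
   mball dist (gam p.1) p.2 `<=` G]]) ball p.1 p.2.
have oW : open W by apply: bigcup_open => -[t r] [_ r0 _]; exact: ball_open.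
suff -> : `[0, l] `&` gam @^-1` G = `[0, l] `&` W.
  by apply: measurableI => //; exact: open_measurable.
apply/seteqP; split=> x [] /=; rewrite in_itv /= => xl.
  move=> /oG [r r0 rG]; split=> //; exists (x, r) => //; exact: ballxx.
move=> [[t r] /= [/andP[t0 tl] r0 rG] xtr]; split=> //; apply: rG.
rewrite /mball /=; apply: le_lt_trans xtr; case/andP: xl => x0 xl.
have [tx|/ltW xt] := leP t x.
  by rewrite distrC ger0_norm ?subr_ge0// (arclength_curve_lip hg).
by rewrite dC ger0_norm ?subr_ge0// (arclength_curve_lip hg).
Qed.

Lemma borel_fun_curve g gam l : borel_fun dist g -> arclength_curve dist gam l ->
  measurable_fun (`[0, l]%classic : set R) (g \o gam).
Proof.
move=> /borel_funE mg hg.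
apply: (@measurable_comp _ _ _ _ (g_sigma_algebraType (mopen dist)) _ setT) => //.
exact: arclength_curve_measurable.
Qed.

(** Measurability of [g] along the curve allows the factor [k] to be taken out of the integral. *)
Lemma upper_gradient_lip (phi : \bar R -> \bar R) (k : R) u g : 0 <= k ->
  (forall a b, `|phi a - phi b| <= k%:E * `|a - b|)%E ->
  upper_gradient dist u g ->
  upper_gradient dist (phi \o u) (fun x => k%:E * g x)%E.
Proof.
move=> k0 phiL [bg [g0 ug]]; split.
  by apply/borel_funE; apply: measurable_funeM; exact/borel_funE.
split=> [x|gam l hg]; first by rewrite mule_ge0.
rewrite (@ge0_integralZl _ _ R (@lebesgue_measure R) _ _ (fun t => g (gam t))) //=.
- by apply: le_trans (phiL _ _) _; rewrite lee_wpmul2l// ug.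
- exact: borel_fun_curve.
Qed.

Lemma upper_gradientD u v g h : (forall x, u x \is a fin_num) ->
  (forall x, v x \is a fin_num) ->
  upper_gradient dist u g -> upper_gradient dist v h ->
  upper_gradient dist (u \+ v)%E (g \+ h)%E.
Proof.
move=> uf vf [bg [g0 ug]] [bh [h0 vh]]; split.
  by apply/borel_funE; apply: emeasurable_funD; exact/borel_funE.
split=> [x|gam l hg]; first by rewrite adde_ge0.
rewrite (@ge0_integralD _ _ R (@lebesgue_measure R) _ _ (fun t => g (gam t)) (fun t => h (gam t))) //=.
- rewrite fin_num_oppeD// addeACA.
  by apply: le_trans (lee_abs_add _ _) _; apply: leeD; [exact: ug|exact: vh].
- exact: borel_fun_curve.
- exact: borel_fun_curve.
Qed.

Lemma borel_fun_nneseries (g : nat -> T -> \bar R) :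
  (forall n x, 0 <= g n x)%E -> (forall n, borel_fun dist (g n)) ->
  borel_fun dist (fun x => \sum_(0 <= n <oo) g n x)%E.
Proof.
move=> g0 bg; apply/borel_funE.
by apply: (ge0_emeasurable_sum (P := xpredT)) => [n x _ _|n _]; [exact: g0|exact/borel_funE].
Qed.

(** The curve integral [I] of the sum bounds the increment of every [u n], hence that of the
    supremum. Values in [0, 1] keep the supremum finite. The sum of the [g n] is used because the
    lattice axioms control the norm of a series. *)
Lemma upper_gradient_sup (u g : nat -> T -> \bar R) :
  (forall n x, 0 <= u n x <= 1)%E ->
  (forall n, upper_gradient dist (u n) (g n)) ->
  upper_gradient dist (fun x => ereal_sup (range (u^~ x)))
    (fun x => \sum_(0 <= n <oo) g n x)%E.
Proof.
move=> u01 ug.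
have g0 n x : (0 <= g n x)%E by have [_ []] := ug n.
have bS : borel_fun dist (fun x => \sum_(0 <= n <oo) g n x)%E.
  by apply: borel_fun_nneseries => // n; have [] := ug n.
split=> //; split=> [x|gam l hg]; first by apply: nneseries_ge0.
set I := (X in (_ <= X)%E).
have uI n : (`|u n (gam 0%R) - u n (gam l)| <= I)%E.
  have [bg [_ /(_ _ _ hg)/le_trans]] := ug n; apply.
  apply: (@ge0_le_integral _ _ R (@lebesgue_measure R) _ _
    (fun t => g n (gam t))) => //=.
  - exact: borel_fun_curve.
  - exact: (borel_fun_curve bS hg).
  - move=> t _; rewrite (nneseriesD1 (n := n))//= leeDl//.
    by apply: nneseries_ge0.
have I0 : (0 <= I)%E by apply: le_trans (uI 0%N).
have s01 x : (0 <= ereal_sup (range (u^~ x)) <= 1)%E.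
  apply/andP; split.
    by apply: le_trans (ereal_sup_ubound _); [|exists 0%N => //]; case/andP: (u01 0%N x).
  by apply: ge_ereal_sup => _ [n _ <-]; case/andP: (u01 n x).
have sf x : ereal_sup (range (u^~ x)) \is a fin_num.
  by case/andP: (s01 x) => h0 h1; rewrite ge0_fin_numE// (le_lt_trans h1)// ltry.
have uf n x : u n x \is a fin_num.
  by case/andP: (u01 n x) => h0 h1; rewrite ge0_fin_numE// (le_lt_trans h1)// ltry.
have key x y : (forall n, `|u n x - u n y| <= I)%E ->
    (ereal_sup (range (u^~ x)) <= ereal_sup (range (u^~ y)) + I)%E.
  move=> h; apply: ge_ereal_sup => _ [n _ <-].
  have := le_trans (lee_abs _) (h n).
  rewrite leeBlDl// => /le_trans; apply; rewrite leeD2r//.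
  by apply: ereal_sup_ubound; exists n.
rewrite -(fineK (sf (gam 0))) -(fineK (sf (gam l))).
apply: abse_EFin_sub_le => // k Ik; split.
  rewrite lerBlDl -lee_fin EFinD !fineK// -Ik; exact: key.
rewrite lerBlDl -lee_fin EFinD !fineK// -Ik; apply: key => n.
by rewrite -abseN fin_num_oppeB// addeC.
Qed.

End Curves.

(** * Capacity *)

Section Capacity.
Context {R : realType} {d0 : measure_display} {T : measurableType d0}.
Variables (dist : T -> T -> R) (mu : {measure set T -> \bar R}).
Variables (N : (T -> \bar R) -> \bar R) (c : R).
Hypothesis dist_metric : is_metric dist.
Hypothesis open_measurable : forall G, mopen dist G -> measurable G.
Hypothesis lattice : qBFL mu N c.
Implicit Types u v g : T -> \bar R.

Lemma ae_all (P : T -> Prop) : (forall x, P x) -> ae mu P.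
Proof.
move=> allP; rewrite /ae; have -> : [set x | ~ P x] = set0.
  by apply/seteqP; split=> x //= /(_ (allP x)).
apply/eqP; rewrite eq_le; apply/andP; split.
  by apply: ereal_inf_lbound; exists set0; [split|exact: measure0].
by apply/ereal_infP => _ [A _ <-].
Qed.

Lemma lattice_c_ge1 : 1 <= c. Proof. by case: lattice. Qed.

Lemma lattice_ge0 u : Defs.mfun u -> (0 <= N u)%E.
Proof. by case: lattice => _ N0 _ _ _; exact: N0. Qed.

Lemma latticeZ (a : R) u : Defs.mfun u ->
  N (fun x => a%:E * u x)%E = (`|a|%:E * N u)%E.
Proof. by case: lattice => _ _ _ NZ _; exact: NZ. Qed.

Lemma latticeD u v : Defs.mfun u -> Defs.mfun v ->
  (N (fun x => u x + v x) <= c%:E * (N u + N v))%E.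
Proof. by case: lattice => _ _ _ _ [ND _ _ _]; exact: ND. Qed.

Lemma lattice_le u v : Defs.mfun u -> Defs.mfun v ->
  (forall x, `|u x| <= `|v x|)%E -> (N u <= N v)%E.
Proof.
case: lattice => _ _ _ _ [_ + _ _] mu_ mv uv.
by apply=> //; exact: ae_all.
Qed.

Lemma lattice_series (u : nat -> T -> \bar R) : (forall n, Defs.mfun (u n)) ->
  (forall n x, 0 <= u n x)%E ->
  (N (fun x => \sum_(0 <= n <oo) u n x) <=
     \sum_(0 <= n <oo) (c ^+ n.+1)%:E * N (u n))%E.
Proof.
case: lattice => _ _ _ _ [_ _ + _] mu_ u0; apply=> // n; exact: ae_all.
Qed.

Lemma borel_mfun g : borel_fun dist g -> Defs.mfun g.
Proof.
move=> bg _ B mB; rewrite setTI; apply: (bg B mB); split=> //=.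
exact: sigma_algebra_measurable.
Qed.

Lemma upper_gradient_mfun u g : upper_gradient dist u g -> Defs.mfun g.
Proof. by case=> /borel_mfun. Qed.

Lemma upper_gradient_norm_ge0 u g : upper_gradient dist u g -> (0 <= N g)%E.
Proof. by move=> /upper_gradient_mfun/lattice_ge0. Qed.

Lemma N1norm_le u g : upper_gradient dist u g -> (N1norm dist N u <= N u + N g)%E.
Proof. by move=> ug; rewrite leeD2l//; apply: ereal_inf_lbound; exists g. Qed.

(** The strict bound forces [N u] to be finite, so it can be subtracted and an upper gradient nearly
    attaining the infimum can be picked. *)
Lemma N1norm_lt u (r : \bar R) : Defs.mfun u -> (N1norm dist N u < r)%E ->
  exists2 g, upper_gradient dist u g & (N u + N g < r)%E.
Proof.
move=> mu_ ur; have i0 : (0 <= ereal_inf [set N g | g in upper_gradient dist u])%E.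
  by apply/ereal_infP => _ [g /upper_gradient_norm_ge0 ? <-].
have uf : N u \is a fin_num.
  rewrite ge0_fin_numE ?lattice_ge0//; apply: le_lt_trans (lt_le_trans ur (leey _)).
  by rewrite leeDl.
move: ur; rewrite /N1norm -lteBrDl// => /ereal_inf_lt[_ [g ug <-]].
by rewrite lteBrDl// => ?; exists g.
Qed.

Lemma mfun_trunc1 u : Defs.mfun u -> Defs.mfun (trunc1 \o u).
Proof.
move=> mu_; apply: measurable_mine; first exact: measurable_cst.
exact: measurableT_comp.
Qed.

(** Any pair [u], [g] bounds the capacity without a check that [u] lies in N^1X: if the bound is
    finite, membership follows. *)
Lemma cap_le (E : set T) u g : Defs.mfun u -> upper_gradient dist u g ->
  (forall x, E x -> 1 <= u x)%E -> (cap dist N E <= N u + N g)%E.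
Proof.
move=> mu_ ug uE; have [->|] := eqVneq (N u + N g)%E +oo%E; first exact: leey.
rewrite -ltey => fin.
have u0 := lattice_ge0 mu_; have g0 := upper_gradient_norm_ge0 ug.
apply: le_trans (N1norm_le ug); apply: ereal_inf_lbound; exists u => //.
split=> //; split; last exact: le_lt_trans (N1norm_le ug) fin.
by split=> //; apply: le_lt_trans fin; rewrite leeDl.
Qed.

(** Truncating a test function keeps it admissible with the same upper gradient and does not
    increase its norm. *)
Lemma cap_lt (E : set T) (r : \bar R) : (cap dist N E < r)%E -> exists u g,
  [/\ Defs.mfun u, upper_gradient dist u g, (forall x, 0 <= u x <= 1)%E,
      (forall x, E x -> 1 <= u x)%E & (N u + N g < r)%E].
Proof.
move=> /ereal_inf_lt[_ [u [[[mu_ _] _] uE] <-]] /(N1norm_lt mu_)[g ug ugr].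
exists (trunc1 \o u), g; split.
- exact: mfun_trunc1.
- have := upper_gradient_lip dist_metric ler01 trunc1_lip ug.
  by under [X in upper_gradient _ _ X]eq_fun do rewrite mul1e.
- by move=> x; exact: trunc1_bounds.
- move=> x /uE ux; rewrite /= /trunc1 le_min lexx /=.
  exact: le_trans ux (lee_abs _).
- apply: le_lt_trans ugr; rewrite leeD2r//; apply: lattice_le => //.
    exact: mfun_trunc1.
  by move=> x; have := trunc1_le (u x); rewrite mul1e.
Qed.

Lemma cap_ge0 (E : set T) : (0 <= cap dist N E)%E.
Proof.
apply/ereal_infP => _ [u [[[mu_ _] _] _] <-].
rewrite adde_ge0 ?lattice_ge0//.
by apply/ereal_infP => _ [g /upper_gradient_norm_ge0 ? <-].
Qed.

Lemma cap_subset (E F : set T) : E `<=` F -> (cap dist N E <= cap dist N F)%E.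
Proof.
by move=> EF; apply: ereal_inf_le_tmp => _ [u [uN uF] <-]; exists u => //; split=> // x /EF/uF.
Qed.

(** A Chebyshev estimate: [|u| / lam] is a test function for the level set. *)
Lemma cap_level u (lam : R) (r : R) : Defs.mfun u -> 0 < lam ->
  (N1norm dist N u < (lam * r)%:E)%E ->
  (cap dist N [set x | (lam%:E <= `|u x|)%E] < r%:E)%E.
Proof.
move=> mu_ l0 /(N1norm_lt mu_)[g ug ugr].
have li0 : 0 < lam^-1 by rewrite invr_gt0.
have mku : Defs.mfun (fun x => lam^-1%:E * u x)%E by exact: measurable_funeM.
have mau : Defs.mfun (fun x => `|lam^-1%:E * u x|)%E by exact: measurableT_comp.
apply: (@le_lt_trans _ _ (N (fun x => `|lam^-1%:E * u x|) + N (fun x => lam^-1%:E * g x))%E).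
  apply: cap_le => //.
    exact: (upper_gradient_lip dist_metric (ltW li0) (fun a b => abse_scale_lip a b li0) ug).
  move=> x /= lx; rewrite abseM gee0_abs ?lee_fin ?(ltW li0)//.
  by rewrite muleC -lee_pdivrMr// ?invr_gt0// invrK mul1e.
apply: (@le_lt_trans _ _ (lam^-1%:E * (N u + N g))%E).
  rewrite muleDr//; last first.
    by apply: ge0_adde_def; rewrite inE lattice_ge0//; exact: upper_gradient_mfun ug.
  apply: leeD.
    rewrite -{2}(gtr0_norm li0) -latticeZ//; apply: lattice_le => // x.
    by rewrite abse_id.
  by rewrite latticeZ ?gtr0_norm//; exact: upper_gradient_mfun ug.
by rewrite muleC lte_pdivrMr// muleC -EFinM.
Qed.

(** Countable quasi-subadditivity. The supremum of the test functions is a test function for the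
    union, and the factors [c ^+ n.+1] of the series axiom cancel against the weights, leaving a sum
    of [eps / 2 ^+ n.+1]. *)
Lemma cap_bigcup (E : nat -> set T) (eps : R) : 0 < eps ->
  (forall n, cap dist N (E n) < (eps / (2 * c) ^+ n.+1)%:E)%E ->
  (cap dist N (\bigcup_n E n) <= eps%:E)%E.
Proof.
move=> e0 capE.
have c0 n : 0 < c ^+ n.+1 by rewrite exprn_gt0// (lt_le_trans ltr01 lattice_c_ge1).
pose P n (p : (T -> \bar R) * (T -> \bar R)) := [/\ Defs.mfun p.1, upper_gradient dist p.1 p.2,
  (forall x, 0 <= p.1 x <= 1)%E, (forall x, E n x -> 1 <= p.1 x)%E &
  (N p.1 + N p.2 < (eps / (2 * c) ^+ n.+1)%:E)%E].
have /choice[p pP] : forall n, exists q, P n q.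
  by move=> n; have [u [g ugP]] := cap_lt (capE n); exists (u, g).
have mu_ n : Defs.mfun (p n).1 by case: (pP n).
have ug n : upper_gradient dist (p n).1 (p n).2 by case: (pP n).
have u01 n x : (0 <= (p n).1 x <= 1)%E by case: (pP n).
have u0 n x : (0 <= (p n).1 x)%E by case/andP: (u01 n x).
have g0 n x : (0 <= (p n).2 x)%E by case: (ug n) => _ [].
have mg n : Defs.mfun (p n).2 by exact: upper_gradient_mfun (ug n).
(* Measurability comes from writing the supremum as the tail supremum starting at index 0. *)
have ms : Defs.mfun (fun x => ereal_sup (range (fun n => (p n).1 x))).
  rewrite (_ : (fun x => _) = (fun x => esups (fun n => (p n).1 x) 0%N)).
    exact: measurable_fun_esups.
  apply/funext => x; rewrite /esups /sdrop /=; congr ereal_sup.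
  by apply/seteqP; split=> _ [n _ <-]; exists n.
have mS : Defs.mfun (fun x => \sum_(0 <= n <oo) (p n).1 x)%E.
  by apply: (ge0_emeasurable_sum (P := xpredT)) => [n x _ _|n _]; [exact: u0|exact: mu_].
have Nu0 n : (0 <= N (p n).1)%E by exact: lattice_ge0.
have Ng0 n : (0 <= N (p n).2)%E by exact: lattice_ge0.
have s0 x : (0 <= ereal_sup (range (fun n => (p n).1 x)))%E.
  by apply: le_trans (ereal_sup_ubound _); last by exists 0%N.
apply: (@le_trans _ _ (N (fun x => ereal_sup (range (fun n => (p n).1 x))) +
    N (fun x => \sum_(0 <= n <oo) (p n).2 x))%E).
  apply: cap_le => //; first exact: upper_gradient_sup.
  move=> x [n _ Enx]; case: (pP n) => _ _ _ /(_ _ Enx)/le_trans + _; apply.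
  by apply: ereal_sup_ubound; exists n.
apply: (@le_trans _ _ (\sum_(0 <= n <oo) (c ^+ n.+1)%:E * N (p n).1 +
   \sum_(0 <= n <oo) (c ^+ n.+1)%:E * N (p n).2)%E).
  apply: leeD; last exact: lattice_series.
  apply: le_trans (lattice_series _ _) => //; apply: lattice_le => // x.
  rewrite !gee0_abs ?nneseries_ge0//; apply: ge_ereal_sup => _ [n _ <-].
  by rewrite (nneseriesD1 (n := n))//= leeDl// nneseries_ge0.
rewrite -nneseriesD => [|n _ _|n _ _]; [|by rewrite mule_ge0// lee_fin ltW..].
apply: le_trans (epsilon_trick0 xpredT (ltW e0)).
apply: lee_nneseries => [n _ _|n _].
  by rewrite adde_ge0// mule_ge0// lee_fin ltW.
rewrite -muleDr ?ge0_adde_def ?inE//.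
case: (pP n) => _ _ _ _ /ltW; rewrite exprMn invfM mulrA EFinM.
by rewrite lee_pdivlMr// muleC natrX.
Qed.

Lemma cap_set0 : cap dist N set0 = 0%E.
Proof.
have m0 : Defs.mfun (fun _ : T => 0%E : \bar R) by exact: measurable_cst.
have N0 : N (fun=> 0%E) = 0%E.
  by have := latticeZ 0 m0; rewrite normr0 !mul0e.
apply/eqP; rewrite eq_le cap_ge0 andbT.
have -> : 0%E = (N (fun=> 0%E) + N (fun=> 0%E))%E by rewrite N0 adde0.
apply: cap_le => //; split; first by apply/borel_funE; exact: measurable_cst.
by split=> // gam l _; rewrite subee// abse0 integral_ge0.
Qed.

(** The exponents 1 and 2 are those of the first two terms of a union padded with empty sets. *)
Lemma cap_setU (E F : set T) (eps : R) : 0 < eps ->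
  (cap dist N E < (eps / (2 * c) ^+ 1)%:E)%E ->
  (cap dist N F < (eps / (2 * c) ^+ 2)%:E)%E ->
  (cap dist N (E `|` F) <= eps%:E)%E.
Proof.
move=> e0 capE capF; pose S n := if n is 0%N then E else if n is 1%N then F else set0.
have -> : E `|` F = \bigcup_n S n.
  apply/seteqP; split=> x; first by case; [exists 0%N|exists 1%N].
  by case=> -[|[|n]] _ //=; [left|right].
apply: cap_bigcup => // -[|[|n]] //=; rewrite cap_set0 lte_fin divr_gt0// exprn_gt0//.
by rewrite mulr_gt0// (lt_le_trans ltr01 lattice_c_ge1).
Qed.

(** * Continuity off an exceptional set, and consequences of a quasiouter capacity *)

Lemma cont_off_subset u (E F : set T) : E `<=` F -> cont_off dist u E ->
  cont_off dist u F.
Proof.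
move=> EF [uf uc]; split=> [x xF|x xF eps e0]; first by apply: uf => /EF.
have [|del d0' h] := uc x _ eps e0; first by move/EF.
by exists del => // y yF; apply: h => /EF.
Qed.

Lemma cont_off_eq u v (E : set T) : (forall x, ~ E x -> u x = v x) ->
  cont_off dist u E -> cont_off dist v E.
Proof.
move=> uv [uf uc]; split=> [x xE|x xE eps e0]; first by rewrite -uv// uf.
have [del d0' h] := uc x xE eps e0.
by exists del => // y yE /(h y yE); rewrite !uv.
Qed.

Lemma cont_off_uniform_limit u (E : set T) :
  (forall eps : R, 0 < eps -> exists2 w, cont_off dist w E &
    forall x, ~ E x -> (`|u x - w x| <= eps%:E)%E) -> cont_off dist u E.
Proof.
move=> H; split=> [x xE|x xE eps e0].
  have [w [wf _] /(_ x xE) uw] := H 1 ltr01.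
  by have [] := fin_num_near (wf x xE) uw.
(* Three errors of at most [eps / 4] add up to less than [eps]. *)
have e4 : 0 < eps / 4 by rewrite divr_gt0.
have [w [wf wc] uw] := H _ e4.
have [del d0' h] := wc x xE _ e4; exists del => // y yE /(h y yE).
have [_ +] := fin_num_near (wf x xE) (uw x xE).
have [_ +] := fin_num_near (wf y yE) (uw y yE).
rewrite !ler_norml !ltr_norml; lra.
Qed.

Lemma propertyC_propertyD : propertyC dist N -> propertyD dist N.
Proof.
move=> [k [k1 qo]] u wqu eps e0; have k0 := lt_le_trans ltr01 k1.
have ek0 : 0 < eps / k by rewrite divr_gt0.
have [E [capE uE]] := wqu _ ek0.
have : (ereal_inf [set cap dist N G | G in [set G | mopen dist G /\ E `<=` G]] < eps%:E)%E.
  apply: le_lt_trans (qo E) _.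
  by rewrite muleC -lte_pdivlMr.
move=> /ereal_inf_lt[_ [G [oG EG] <-] capG]; exists G; split=> //.
exact: cont_off_subset uE.
Qed.

Lemma propertyC_propertyE : propertyC dist N -> propertyE dist N.
Proof.
move=> [k [k1 qo]] E capE eps e0; have := qo E; rewrite capE mule0 => qoE.
have /ereal_inf_lt[_ [G [oG EG] <-] capG] : (ereal_inf
   [set cap dist N G | G in [set G | mopen dist G /\ E `<=` G]] < eps%:E)%E.
  by apply: le_lt_trans qoE _; rewrite lte_fin.
by exists G.
Qed.

(** * Consequences of the density of continuous functions *)

Section Density.
Hypothesis dense : cont_dense dist N.

(** By the Chebyshev estimate at level [2 ^- k], the set where [u] and [w k] differ by at least
    [2 ^- k] has capacity below [(2c)^-(k+1)], which is summable in the sense of [cap_bigcup] from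
    any index [j] on. *)
Lemma quasiuniform_approximation u : inN1X dist N u -> exists w : nat -> T -> \bar R,
  (forall n, cont_off dist (w n) set0) /\
  forall j, (cap dist N (\bigcup_n [set x | ((2 ^- (j + n))%:E <=
     `|u x - w (j + n)%N x|)%E]) <= (2 ^- j)%:E)%E.
Proof.
move=> uN; have [[mu_ _] _] := uN.
have c1 := lattice_c_ge1; have c0 := lt_le_trans ltr01 c1.
(* The level [2 ^- k] times the capacity wanted for the level set. *)
pose r k : R := 2 ^- k * (1 / (2 * c) ^+ k.+1).
have r0 k : 0 < r k by rewrite mulr_gt0 ?divr_gt0 ?exprn_gt0 ?invr_gt0 ?mulr_gt0// exprn_gt0.
have /choice[w wP] : forall k, exists v, [/\ inN1X dist N v, cont_off dist v set0 &
    (N1norm dist N (fun x => u x - v x) < (r k)%:E)%E].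
  by move=> k; exact: dense.
exists w; split=> [n|j]; first by case: (wP n).
apply: cap_bigcup => [|n]; first by rewrite invr_gt0 exprn_gt0.
have [[[mw _] _] _ uw] := wP (j + n)%N.
apply: (@lt_le_trans _ _ (1 / (2 * c) ^+ (j + n).+1)%:E).
  apply: cap_level uw; last by rewrite invr_gt0 exprn_gt0.
  exact: emeasurable_funB.
(* The extra factor [(2c)^-j] is at most [2 ^- j] because [1 <= c]. *)
rewrite lee_fin -addnS exprD mul1r invfM.
rewrite ler_pM2r ?invr_gt0 ?exprn_gt0 ?mulr_gt0//.
rewrite lef_pV2 ?posrE ?exprn_gt0 ?mulr_gt0// exprMn ler_peMr ?exprn_ge0//.
exact: exprn_ege1.
Qed.

Lemma density_propertyG : propertyG dist N.
Proof.
move=> u uN eps e0; have [w [wc capF]] := quasiuniform_approximation uN.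
have [j jeps] := inv_exp2_small e0.
eexists; split; first by apply: le_lt_trans (capF j) _; rewrite lte_fin.
apply: cont_off_uniform_limit => eps' e'0; have [n neps'] := inv_exp2_small e'0.
exists (w (j + n)%N); first by apply: cont_off_subset (wc _).
move=> x nF; rewrite leNgt; apply/negP => xw; apply: nF; exists n => //=.
apply: le_trans (ltW xw); rewrite lee_fin; apply: le_trans (ltW neps').
by rewrite lef_pV2 ?posrE ?exprn_gt0// ler_weXn2l ?ler1n// leq_addl.
Qed.

Lemma density_propertyF : propertyF dist N.
Proof.
move=> u uN; have [w [wc capF]] := quasiuniform_approximation uN.
pose F k := [set x | ((2 ^- k)%:E <= `|u x - w k x|)%E].
(* The threshold exceeds [2 ^- k + 2 ^- k.+1], so a point of [G k] lies in [F k] or [F k.+1]; the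
   strict inequality between continuous functions makes [G k] open. *)
pose G k := [set x | 2 * 2 ^- k < `|fine (w k.+1 x) - fine (w k x)|].
pose tF j := \bigcup_n F (j + n)%N; pose tG j := \bigcup_n G (j + n)%N.
have wf k x : w k x \is a fin_num by have [+ _] := wc k; exact.
have pow2S k : 2 ^- k = 2 * 2 ^- k.+1 :> R.
  by rewrite exprS invfM mulrA divff// mul1r.
have pow2_gt0 k : 0 < 2 ^- k :> R by rewrite invr_gt0 exprn_gt0.
have notF k x : ~ F k x -> u x \is a fin_num /\ `|fine (u x) - fine (w k x)| <= 2 ^- k.
  by move=> /negP; rewrite -ltNge => /ltW /fin_num_near -/(_ (wf k x)).
have tGF j : tG j `<=` tF j.
  move=> x [n _ Gx]; apply: contrapT => nF.
  have [_ h0] : u x \is a fin_num /\ `|fine (u x) - fine (w (j + n)%N x)| <= 2 ^- (j + n).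
    by apply: notF => Fx; apply: nF; exists n.
  have [_ h1] : u x \is a fin_num /\ `|fine (u x) - fine (w (j + n).+1 x)| <= 2 ^- (j + n).+1.
    by apply: notF => Fx; apply: nF; exists n.+1 => //; rewrite addnS.
  move: Gx; rewrite /G /= ltNge => /negP; apply.
  have := pow2_gt0 (j + n)%N; have := pow2S (j + n)%N.
  by move: h0 h1; rewrite !ler_norml; lra.
have oG k : mopen dist (G k).
  (* Half of the excess over the threshold: each of the two functions may vary by less than [e]. *)
  move=> x Gx; pose e := (`|fine (w k.+1 x) - fine (w k x)| - 2 * 2 ^- k) / 2.
  have e0 : 0 < e by rewrite divr_gt0// subr_gt0.
  have [d1 d10 h1] := (wc k.+1).2 x (@id False) e e0.
  have [d2 d20 h2] := (wc k).2 x (@id False) e e0.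
  exists (Num.min d1 d2); first by rewrite lt_min d10.
  move=> y; rewrite /mball /= lt_min => /andP[/(h1 y (@id False)) y1 /(h2 y (@id False)) y2].
  rewrite /G /=.
  have := ler_dist_dist (fine (w k.+1 x) - fine (w k x)) (fine (w k.+1 y) - fine (w k y)).
  rewrite ler_norml => /andP[_].
  have -> : fine (w k.+1 x) - fine (w k x) - (fine (w k.+1 y) - fine (w k y)) =
    (fine (w k y) - fine (w k x)) - (fine (w k.+1 y) - fine (w k.+1 x)) by ring.
  have := ler_normB (fine (w k y) - fine (w k x)) (fine (w k.+1 y) - fine (w k.+1 x)).
  by rewrite /e in y1 y2; lra.
have otG j : mopen dist (tG j).
  move=> x [n _ /oG[r r0 rG]]; exists r => // y /rG Gy; by exists n.
(* The bound is the exact geometric sum of the increments [2 * 2 ^- i] for [k <= i < k + m], which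
   makes the induction close. *)
have tGcauchy j x k m : ~ tG j x -> (j <= k)%N ->
    `|fine (w (k + m)%N x) - fine (w k x)| <= 4 * 2 ^- k - 4 * 2 ^- (k + m).
  move=> nG jk; elim: m => [|m]; first by rewrite addn0 !subrr normr0.
  have : `|fine (w (k + m).+1 x) - fine (w (k + m)%N x)| <= 2 * 2 ^- (k + m).
    rewrite leNgt; apply/negP => Gx; apply: nG; exists (k + m - j)%N => //.
    by rewrite subnKC// (leq_trans jk)// leq_addr.
  rewrite addnS; have := pow2S (k + m)%N; rewrite !ler_norml; lra.
(* The upper limit of the [w k x]: it is defined at every point and is the limit wherever the
   sequence converges. *)
pose v x := ereal_inf (range (esups (w^~ x))).
have vw j x k : ~ tG j x -> (j <= k)%N -> (`|v x - w k x| <= (4 * 2 ^- k)%:E)%E.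
  move=> nG jk.
  have bnd m : (k <= m)%N -> `|fine (w m x) - fine (w k x)| <= 4 * 2 ^- k.
    move=> km; rewrite -(subnKC km); apply: le_trans (tGcauchy _ _ _ _ nG jk) _.
    by rewrite gerBl mulr_ge0// ltW.
  have vub : (v x <= (fine (w k x) + 4 * 2 ^- k)%:E)%E.
    apply: le_trans (ereal_inf_lbound _) _; first by exists k.
    apply: ge_ereal_sup => _ [m km <-]; rewrite -(fineK (wf m x)) lee_fin.
    by have := bnd _ km; rewrite ler_norml; lra.
  have vlb : ((fine (w k x) - 4 * 2 ^- k)%:E <= v x)%E.
    apply/ereal_infP => _ [n _ <-].
    apply: (@le_trans _ _ (w (maxn n k) x)); last first.
      by apply: ereal_sup_ubound; exists (maxn n k) => //=; rewrite leq_maxl.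
    rewrite -[leRHS](fineK (wf _ x)) lee_fin.
    by have := bnd _ (leq_maxr n k); rewrite ler_norml; lra.
  move: vub vlb; case: (v x) => [a| |]//=; rewrite -(fineK (wf k x)) !lee_fin => ? ?.
  by rewrite ler_norml; lra.
exists v; split.
  move=> eps e0; have [j jeps] := inv_exp2_small e0; exists (tG j); split=> //.
    apply: le_lt_trans (cap_subset (tGF j)) _; apply: le_lt_trans (capF j) _.
    by rewrite lte_fin.
  apply: cont_off_uniform_limit => eps' e'0.
  have [n neps'] := inv_exp2_small (divr_gt0 e'0 (ltr0n R 4)).
  exists (w (j + n)%N); first exact: cont_off_subset (wc _).
  move=> x nG; apply: le_trans (vw _ _ _ nG (leq_addr _ _)) _.
  rewrite lee_fin mulrC -ler_pdivlMr//; apply: le_trans (ltW neps').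
  by rewrite lef_pV2 ?posrE ?exprn_gt0// ler_weXn2l ?ler1n// leq_addl.
(* The intersection is null because [tF j] has capacity at most [2 ^- j]; at any other point [u] and
   [v] are both limits of the same sequence. *)
exists (\bigcap_j tF j); split.
  apply/eqP; rewrite eq_le cap_ge0 andbT; apply/lee_addgt0Pr => eps e0.
  rewrite add0e; have [j jeps] := inv_exp2_small e0.
  apply: (@le_trans _ _ (cap dist N (tF j))); first by apply: cap_subset => x; exact.
  by apply: le_trans (capF j) _; rewrite lee_fin ltW.
move=> x /existsNP[j /not_implyP[_ nF]].
have nG : ~ tG j x by move=> /tGF.
have unF n : u x \is a fin_num /\ `|fine (u x) - fine (w (j + n)%N x)| <= 2 ^- (j + n).
  by apply: notF => Fx; apply: nF; exists n.
have vnF n := fin_num_near (wf _ x) (vw j x (j + n)%N nG (leq_addr _ _)).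
have [uf _] := unF 0%N; have [vf _] := vnF 0%N.
rewrite -(fineK uf) -(fineK vf); congr EFin.
apply/eqP; rewrite -subr_eq0 -normr_le0 -lee_fin; apply/lee_addgt0Pr => eps e0.
(* The distances of [u] and [v] to [w (j + n)] are at most 1 and 4 times [2 ^- (j + n)], hence the
   5. *)
rewrite add0e lee_fin; have [n neps] := inv_exp2_small (divr_gt0 e0 (ltr0n R 5)).
have [_ +] := unF n; have [_ +] := vnF n.
have : 2 ^- (j + n) <= 2 ^- n :> R.
  by rewrite lef_pV2 ?posrE ?exprn_gt0// ler_weXn2l ?ler1n// leq_addl.
by move: neps; rewrite !ler_norml; lra.
Qed.

Lemma propertyE_propertyA : propertyE dist N -> propertyA dist N.
Proof.
move=> pE u uN eps e0; have [v [vq [Z [Z0 vu]]]] := density_propertyF uN.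
have c0 : 0 < c by exact: lt_le_trans ltr01 lattice_c_ge1.
(* Halving turns the non-strict bound for the union into the strict one required. *)
have e20 : 0 < eps / 2 by rewrite divr_gt0.
have [|V [oV capV vV]] := vq (eps / 2 / (2 * c) ^+ 1).
  by rewrite divr_gt0// exprn_gt0// mulr_gt0.
have [|G [oG ZG capG]] := pE Z Z0 (eps / 2 / (2 * c) ^+ 2).
  by rewrite divr_gt0// exprn_gt0// mulr_gt0.
exists (V `|` G); split.
- move=> x [/oV|/oG] [r r0 rV]; exists r => // y /rV; by [left|right].
- by apply: le_lt_trans (cap_setU e20 capV capG) _; rewrite lte_fin; lra.
- apply: (@cont_off_eq v); last by apply: cont_off_subset vV; exact: subsetUl.
  by move=> x nVG; apply: vu => /ZG Gx; apply: nVG; right.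
Qed.

End Density.

(** * From quasicontinuity to an outer capacity *)

(** The quasi-triangle inequality alone would lose a factor [c] in the limit. It is applied only to
    the difference from [f], whose norm tends to 0; continuity of the quasinorm does the rest. *)
Lemma lattice_perturbation (f : T -> \bar R) (h : nat -> T -> \bar R) :
  Defs.mfun f -> (forall x, 0 <= f x)%E -> (N f < +oo)%E ->
  (forall n, Defs.mfun (h n)) -> (forall n x, 0 <= h n x)%E ->
  (forall n, N (h n) <= (harmonic n)%:E)%E ->
  (fun n => N (fun x => (1 + harmonic n)%:E * f x + h n x)%E) @ \oo --> N f.
Proof.
move=> mf f0 Nf mh h0 Nh.
have Nff : N f \is a fin_num by rewrite ge0_fin_numE// lattice_ge0.
have Nf0 : 0 <= fine (N f) by rewrite fine_ge0// lattice_ge0.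
have c0 : 0 < c by exact: lt_le_trans ltr01 lattice_c_ge1.
have hg n : 0 < harmonic n :> R by exact: harmonic_gt0.
have mZ (a : R) : Defs.mfun (fun x => a%:E * f x)%E by exact: measurable_funeM.
have NL (a : R) n : 0 <= a -> (N (fun x => a%:E * f x + h n x) <=
   (c * (a * fine (N f) + harmonic n))%:E)%E.
  move=> a0; apply: le_trans (latticeD (mZ a) (mh n)) _.
  rewrite EFinM lee_wpmul2l ?lee_fin ?(ltW c0)// EFinD leeD//.
  by rewrite latticeZ// ger0_norm// EFinM fineK.
have mU (a : R) n : Defs.mfun (fun x => a%:E * f x + h n x)%E.
  exact: emeasurable_funD (mZ a) (mh n).
have mB n : Defs.mfun (fun x => (1 + harmonic n)%:E * f x + h n x - f x)%E.
  exact: emeasurable_funB (mU _ n) mf.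
case: lattice => _ _ _ _ [_ _ _]; apply=> //.
  move=> n; split; first exact: mU.
  by apply: le_lt_trans (NL _ _ _) (ltry _); rewrite addr_ge0// ltW.
apply: (@squeeze_cvge _ _ _ _ (cst 0%E) _
    (fun n => ((c * (fine (N f) + 1)) * harmonic n)%:E)).
- apply: nearW => n; apply/andP; split.
    exact: lattice_ge0 (mB n).
  apply: (@le_trans _ _ (N (fun x => (harmonic n)%:E * f x + h n x)%E)).
    apply: lattice_le (mB n) _ _ => //.
    (* If [f x] or [h n x] is infinite the right-hand side is [+oo]; otherwise both sides agree. *)
    move=> x; have := f0 x; have := h0 n x; have := hg n.
    case: (f x) (h n x) => [a| |] [b| |]//= k0 _ _; rewrite ?gt0_muley ?lte_fin ?addr_gt0//= ?leey//.
    rewrite lee_fin le_eqVlt; apply/orP; left; apply/eqP; congr `|_|; ring.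
  apply: le_trans (NL _ _ (ltW (hg n))) _.
  rewrite lee_fin -mulrA ler_pM2l//; lra.
- exact: cvg_cst.
- rewrite -[X in _ --> X]/((0%R)%:E); apply: cvg_EFin; first exact: nearW.
  rewrite -(mulr0 (c * (fine (N f) + 1))); apply: cvgMl_tmp; exact: cvg_harmonic.
Qed.

Lemma propertyA_propertyB : propertyA dist N -> propertyB dist N.
Proof.
move=> pA E; rewrite mul1e; have [->|] := eqVneq (cap dist N E) +oo%E.
  exact: leey.
rewrite -ltey => capEoo.
have capEf : cap dist N E \is a fin_num by rewrite ge0_fin_numE// cap_ge0.
apply/lee_addgt0Pr => e e0.
have /cap_lt[u [g [mu_ ug u01 uE ugr]]] : (cap dist N E < cap dist N E + e%:E)%E.
  by rewrite lteDl// lte_fin.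
have mg := upper_gradient_mfun ug.
have g0 x : (0 <= g x)%E by case: ug => _ [].
have u0 x : (0 <= u x)%E by case/andP: (u01 x).
have uf x : u x \is a fin_num.
  by case/andP: (u01 x) => ? h1; rewrite ge0_fin_numE// (le_lt_trans h1)// ltry.
have Nu0 := lattice_ge0 mu_; have Ng0 := lattice_ge0 mg.
have ugoo : (N u + N g < +oo)%E by apply: lt_le_trans ugr (leey _).
have Nuoo : (N u < +oo)%E by apply: le_lt_trans ugoo; rewrite leeDl.
have Ngoo : (N g < +oo)%E by apply: le_lt_trans ugoo; rewrite leeDr.
have uN : inN1X dist N u.
  by split=> //; exact: le_lt_trans (N1norm_le ug) ugoo.
have hg n : 0 < harmonic n :> R by exact: harmonic_gt0.
(* Open sets of capacity below [1/(n+1)] off which [u] is continuous. *)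
have /choice[G GP] n := pA u uN _ (hg n).
pose P n (p : (T -> \bar R) * (T -> \bar R)) := [/\ Defs.mfun p.1, upper_gradient dist p.1 p.2,
  (forall x, 0 <= p.1 x <= 1)%E, (forall x, G n x -> 1 <= p.1 x)%E &
  (N p.1 + N p.2 < (harmonic n)%:E)%E].
have /choice[p pP] : forall n, exists q, P n q.
  move=> n; have [_ capG _] := GP n.
  by have [w [h whP]] := cap_lt capG; exists (w, h).
have mw n : Defs.mfun (p n).1 by case: (pP n).
have wh n : upper_gradient dist (p n).1 (p n).2 by case: (pP n).
have w01 n x : (0 <= (p n).1 x <= 1)%E by case: (pP n).
have w0 n x : (0 <= (p n).1 x)%E by case/andP: (w01 n x).
have wf n x : (p n).1 x \is a fin_num.
  by case/andP: (w01 n x) => ? h1; rewrite ge0_fin_numE// (le_lt_trans h1)// ltry.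
have h0 n x : (0 <= (p n).2 x)%E by case: (wh n) => _ [].
have mh n : Defs.mfun (p n).2 by exact: upper_gradient_mfun (wh n).
have Nw n : (N (p n).1 <= (harmonic n)%:E)%E.
  by case: (pP n) => _ _ _ _ /ltW; apply: le_trans; rewrite leeDl// lattice_ge0.
have Nh n : (N (p n).2 <= (harmonic n)%:E)%E.
  by case: (pP n) => _ _ _ _ /ltW; apply: le_trans; rewrite leeDr// lattice_ge0.
have cvu := lattice_perturbation mu_ u0 Nuoo mw w0 Nw.
have cvg := lattice_perturbation mg g0 Ngoo mh h0 Nh.
have cvs := cvgeD (ge0_adde_def Nu0 Ng0) cvu cvg.
(* The limit [N u + N g] lies strictly below the target, so some index [n] already does. *)
have /cvs : nbhs (N u + N g)%E [set y | (y < cap dist N E + e%:E)%E].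
  by apply: open_nbhs_nbhs; split; [exact: open_ereal_lt_ereal|].
case=> n _ /(_ n (leqnn n)) /= /ltW.
set U := fun x => _; set H := fun x => _ => lt.
pose a : R := 1 + harmonic n.
have a0 : 0 < a by rewrite addr_gt0.
(* Since [a > 1], the strict inequality holds on [E], where [u >= 1]; strictness and continuity off
   [G n] make [V] open. *)
pose V := G n `|` [set x | 1 < a * fine (u x)].
apply: le_trans lt.
apply: (@le_trans _ _ (cap dist N V)).
  apply: ereal_inf_lbound; exists V => //; split; last first.
    move=> x /uE ux; right => /=; apply: (@lt_le_trans _ _ a).
      by rewrite ltrDl.
    by rewrite ler_peMr ?(ltW a0)// -lee_fin fineK.
  have [oG _ [_ uc]] := GP n.
  move=> x; have [/oG[r r0 rG] _|nG] := pselect (G n x).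
    by exists r => // y /rG; left.
  case=> // /= ux; have e1 : 0 < (a * fine (u x) - 1) / a by rewrite divr_gt0// subr_gt0.
  have [del del0 h] := uc x nG _ e1; exists del => // y xy.
  have [Gy|nGy] := pselect (G n y); [by left|right => /=].
  have := h y nGy xy; rewrite ltr_pdivlMr// -[X in `|_| * X](gtr0_norm a0).
  by rewrite -normrM ltr_norml; lra.
apply: cap_le.
- exact: emeasurable_funD (measurable_funeM a%:E mu_) (mw n).
- apply: upper_gradientD => //; first by move=> x; rewrite fin_numM.
  apply: (upper_gradient_lip dist_metric (phi := fun t => mule a%:E t) (ltW a0)) ug.
  move=> s t; case: s t => [s| |] [t| |]//=; rewrite ?gt0_muley ?gt0_muleNy ?lte_fin//= ?leey//.
  by rewrite lee_fin -mulrBr normrM gtr0_norm.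
(* The test function [a u + w_n] is at least 1 on [V]: through [w_n] on [G n], through [a u]
   elsewhere. *)
- move=> x [Gx|/= ux].
    case: (pP n) => _ _ _ /(_ _ Gx)/le_trans + _; apply.
    by rewrite leeDr// mule_ge0// lee_fin ltW.
  apply: (@le_trans _ _ (a%:E * u x)%E); last by rewrite leeDl.
  by rewrite -(fineK (uf x)) lee_fin ltW.
Qed.

(** The cycle (A), (B), (C), (D), (A), where (D) gives (A) through (G), is completed by the detour
    from (C) through (E) to (A). *)
Lemma dense_properties_equivalent : cont_dense dist N ->
  [/\ (propertyA dist N <-> propertyB dist N), (propertyA dist N <-> propertyC dist N),
      (propertyA dist N <-> propertyD dist N), (propertyA dist N <-> propertyE dist N) &
      propertyF dist N /\ propertyG dist N].
Proof.
move=> dense.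
have AB := propertyA_propertyB.
have BC : propertyB dist N -> propertyC dist N by move=> pB; exists 1.
have CD := propertyC_propertyD; have CE := propertyC_propertyE.
have DA : propertyD dist N -> propertyA dist N.
  by move=> pD u /(density_propertyG dense)/pD.
have EA := propertyE_propertyA dense.
split; [tauto..|split].
- exact: density_propertyF.
- exact: density_propertyG.
Qed.

End Capacity.

(** * Absence of rectifiable curves in an ultrametric space *)

Section UltrametricCurves.
Context {R : realType} {d0 : measure_display} {T : measurableType d0}.
Variable dist : T -> T -> R.
Hypothesis dist_metric : is_metric dist.
Hypothesis dist_ultra : forall x y z, dist x z <= Num.max (dist x y) (dist y z).

(** The ultrametric inequality takes the maximum over the two halves of an interval, not the sum, so
    each bisection halves the Lipschitz bound. *)
Lemma ultrametric_lip_le gam (l : R) :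
  (forall s t, 0 <= s -> s <= t -> t <= l -> dist (gam s) (gam t) <= t - s) ->
  forall k s t, 0 <= s -> s <= t -> t <= l -> dist (gam s) (gam t) <= (t - s) / 2 ^+ k.
Proof.
move=> lip; elim=> [|k IH] s t s0 st tl; first by rewrite expr0 divr1 lip.
pose m := (s + t) / 2.
apply: le_trans (dist_ultra _ (gam m) _) _; rewrite exprS invfM mulrA ge_max.
apply/andP; split.
  by rewrite (_ : (t - s) / 2 = m - s) ?IH//; rewrite /m; lra.
by rewrite (_ : (t - s) / 2 = t - m) ?IH//; rewrite /m; lra.
Qed.

Lemma ultrametric_no_curve gam (l : R) : ~ arclength_curve dist gam l.
Proof.
move=> hg; have [l0 len] := hg; have [dge0 _] := dist_metric.
have d0' s t : 0 <= s -> s <= t -> t <= l -> dist (gam s) (gam t) = 0.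
  move=> s0 st tl; apply/eqP; rewrite eq_le dge0 andbT -lee_fin.
  apply/lee_addgt0Pr => e e0; rewrite add0e lee_fin.
  (* Adding 1 keeps the denominator positive when [s = t]. *)
  have e1 : 0 < e / (t - s + 1) by rewrite divr_gt0//; lra.
  have [k ke] := inv_exp2_small e1.
  apply: le_trans (ultrametric_lip_le (arclength_curve_lip hg) k s0 st tl) _.
  have := ltW ke; rewrite ler_pdivlMr; last by lra.
  apply: le_trans; rewrite mulrC ler_wpM2l ?invr_ge0 ?exprn_ge0//; lra.
have := len 0 l (lexx _) (ltW l0) (lexx _); rewrite subr0 => lenl.
suff : (curve_length dist gam 0 l <= 0)%E by rewrite lenl lee_fin leNgt l0.
apply: ge_ereal_sup => _ [n [p [p0 pn pm ->]]].
have pmono i j : (i <= j)%N -> (j <= n)%N -> p i <= p j.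
  move=> ij; elim: j ij => [|j IH]; first by rewrite leqn0 => /eqP ->.
  rewrite leq_eqVlt => /predU1P[->//|]; rewrite ltnS => ij jn.
  exact: le_trans (IH ij (ltnW jn)) (pm _ jn).
rewrite big1// => i _; rewrite d0'//.
- by rewrite -p0 pmono// ltnW.
- exact: pm.
- by rewrite -pn pmono.
Qed.

Lemma ultrametric_upper_gradient0 (u : T -> \bar R) :
  upper_gradient dist u (fun=> 0%E).
Proof.
split; first by apply/borel_funE; exact: measurable_cst.
by split=> // gam l /ultrametric_no_curve.
Qed.

End UltrametricCurves.

(** * A convergent sequence whose limit point is null *)

Section ConvergentSequence.
Context {R : realType}.

(* The space [{0} U {1/n : n >= 1}] with [n] standing for [1/n] and [0] for the
   limit point: in MathComp [0^-1 = 0]. *)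
Definition seq_dist (x y : nat) : R :=
  if x == y then 0 else Num.max x%:R^-1 y%:R^-1.

Lemma seq_dist_ultra x y z : seq_dist x z <= Num.max (seq_dist x y) (seq_dist y z).
Proof.
have [<-|xy] := eqVneq x y; first by rewrite le_max lexx orbT.
have [<-|yz] := eqVneq y z; first by rewrite le_max lexx.
rewrite /seq_dist (negbTE xy) (negbTE yz); case: ifP => _.
  by rewrite !le_max invr_ge0 ler0n.
by rewrite ge_max !le_max !lexx !orbT.
Qed.

Lemma seq_dist_metric : @is_metric R _ nat seq_dist.
Proof.
have d0 x y : 0 <= seq_dist x y.
  by rewrite /seq_dist; case: ifP => // _; rewrite le_max invr_ge0 ler0n.
split=> //; split=> [x y|]; last split=> [x y|x y z].
- split=> [|->]; last by rewrite /seq_dist eqxx.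
  rewrite /seq_dist; case: eqVneq => // xy max0.
  have : 0 < Num.max x%:R^-1 y%:R^-1 :> R.
    by rewrite lt_max !invr_gt0 !ltr0n; case: x y xy {max0} => [|x] [|y].
  by rewrite max0 ltxx.
- by rewrite /seq_dist eq_sym maxC.
- by apply: le_trans (seq_dist_ultra x y z) _; rewrite ge_max lerDl lerDr !d0.
Qed.

Lemma seq_ball0 (r : R) : 0 < r ->
  exists n0, forall n, (n0 <= n)%N -> mball (T := nat) seq_dist 0%N r n.
Proof.
move=> r0; exists (Num.truncn r^-1).+1 => n rn; rewrite /mball /= /seq_dist.
case: ifP => // _; rewrite invr0 gt_max r0 -[ltRHS]invrK.
have n0 : (0 < n)%N by exact: leq_trans rn.
rewrite ltf_pV2 ?posrE ?ltr0n ?invr_gt0//.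
by apply: lt_le_trans (truncnS_gt _) _; rewrite ler_nat.
Qed.

(** The member covering the limit point contains a tail; finitely many members cover the remaining
    points. *)
Lemma seq_compact : @metric_compact R _ nat seq_dist.
Proof.
move=> I G oG cov; have /choice[f fG] := cov.
have [r r0 rG] := oG _ _ (fG 0%N); have [n0 n0P] := seq_ball0 r0.
exists n0.+1, f => x; have [xn|nx] := ltnP x n0.+1; first by exists x.
by exists 0%N => //; apply: rG; apply: n0P; exact: ltnW.
Qed.

(** * A finite measure on the sequence *)

Definition seq_weight (n : nat) : {nonneg R} := (2 ^- n.+1)%:nng.

(** Point masses [2 ^- n.+1] at [n.+1]: the limit point 0 is null although all balls around it have
    positive measure. *)
Definition seq_mu : {measure set nat -> \bar R} :=
  mseries (fun n => mscale (seq_weight n) (dirac n.+1)) 0.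

Lemma seq_muE (A : set nat) : seq_mu A =
  (\sum_(0 <= n <oo) (2 ^- n.+1)%:E * (\1_A n.+1)%:E)%E.
Proof. by []. Qed.

Lemma seq_mu_eq0 (A : set nat) : seq_mu A = 0%E <-> forall n, ~ A n.+1.
Proof.
rewrite seq_muE; split=> [mu0 n An|nA].
  suff : ((2 ^- n.+1)%:E <= 0 :> \bar R)%E by rewrite lee_fin leNgt invr_gt0 exprn_gt0.
  rewrite -mu0 (nneseriesD1 (n := n))//.
  by rewrite indicE mem_set// mule1 leeDl// nneseries_ge0.
apply: eseries0 => n _ _; rewrite indicE memNset ?mule0//; exact: nA.
Qed.

Lemma seq_mu_lty A : (seq_mu A < +oo)%E.
Proof.
rewrite seq_muE.
apply: le_lt_trans (le_lt_trans (epsilon_trick0 xpredT ler01) (ltry _)).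
apply: lee_nneseries => // n _.
by rewrite -EFinM lee_fin mul1r natrX ler_piMr.
Qed.

(** Every subset of [nat] is measurable, so the outer measure is the measure itself. *)
Lemma seq_ae (P : nat -> Prop) : ae seq_mu P <-> forall n, P n.+1.
Proof.
have outer A : outer_mu seq_mu A = seq_mu A.
  apply/eqP; rewrite eq_le; apply/andP; split.
    by apply: ereal_inf_lbound; exists A => //; split.
  by apply/ereal_infP => _ [B [_ AB] <-]; apply: le_measure; rewrite ?inE.
rewrite /ae outer seq_mu_eq0; split=> h n; last exact.
by apply: contrapT; exact: h.
Qed.

Lemma seq_standing : standing_assumptions seq_dist seq_mu.
Proof.
split=> //; first exact: seq_dist_metric.
move=> x r r0; split; last exact: seq_mu_lty.
rewrite lt_neqAle measure_ge0 andbT eq_sym; apply/eqP => /seq_mu_eq0.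
have [n0 n0P] := seq_ball0 r0.
case: x => [|n] nb; first by apply: (nb n0); apply: n0P.
by apply: (nb n); rewrite /mball /= /seq_dist eqxx.
Qed.

(** * The lattice of absolutely summable sequences *)

(** Unweighted, unlike [seq_mu]: a function that is at least 1 on a tail has infinite norm, while
    the value at 0 does not count. *)
Definition seq_norm (u : nat -> \bar R) : \bar R :=
  (\sum_(0 <= n <oo) `|u n.+1|)%E.

Lemma seq_norm_ge0 u : (0 <= seq_norm u)%E.
Proof. exact: nneseries_ge0. Qed.

Lemma seq_norm_ge u n : (`|u n.+1| <= seq_norm u)%E.
Proof. by rewrite /seq_norm (nneseriesD1 (n := n))//= leeDl// nneseries_ge0. Qed.

Lemma seq_normD u v : (seq_norm (fun x => u x + v x) <= seq_norm u + seq_norm v)%E.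
Proof.
rewrite /seq_norm -nneseriesD//; apply: lee_nneseries => // n _; exact: lee_abs_add.
Qed.

Lemma seq_norm_le u v : (forall n, `|u n.+1| <= `|v n.+1|)%E ->
  (seq_norm u <= seq_norm v)%E.
Proof. by move=> uv; apply: lee_nneseries. Qed.

Lemma seq_norm_fin u n : (seq_norm u < +oo)%E -> u n.+1 \is a fin_num.
Proof.
by move=> /(le_lt_trans (seq_norm_ge u n)); rewrite -ge0_fin_numE// abse_fin_num.
Qed.

Lemma seq_norm_abs u : seq_norm (fun x => `|u x|%E) = seq_norm u.
Proof. by apply: eq_eseriesr => n _; rewrite abse_id. Qed.

(** The triangle inequality and its reverse squeeze the norms; finite norm makes the values at
    positive indices finite, so they can be subtracted. *)
Lemma seq_norm_cvg (un : nat -> nat -> \bar R) u :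
  (forall n, seq_norm (un n) < +oo)%E -> (seq_norm u < +oo)%E ->
  (fun n => seq_norm (fun x => un n x - u x)%E) @ \oo --> 0%E ->
  (fun n => seq_norm (un n)) @ \oo --> seq_norm u.
Proof.
move=> unoo uoo cv.
have uf : seq_norm u \is a fin_num by rewrite ge0_fin_numE// seq_norm_ge0.
have df n : seq_norm (fun x => un n x - u x)%E \is a fin_num.
  rewrite ge0_fin_numE ?seq_norm_ge0//; apply: (@le_lt_trans _ _
    (seq_norm (un n) + seq_norm (fun x => - u x))%E); first exact: seq_normD.
  rewrite lte_add_pinfty//; apply: le_lt_trans uoo; apply: seq_norm_le => k.
  by rewrite abseN.
apply: (@squeeze_cvge _ _ _ _
   (fun n => seq_norm u - seq_norm (fun x => un n x - u x))%E _
   (fun n => seq_norm u + seq_norm (fun x => un n x - u x))%E).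
- apply: nearW => n; apply/andP; split.
    rewrite leeBlDr// -(seq_norm_abs (un n)) -(seq_norm_abs (fun x => un n x - u x)%E).
    apply: le_trans (seq_normD _ _); apply: seq_norm_le => k.
    rewrite -(fineK (seq_norm_fin k uoo)) -(fineK (seq_norm_fin k (unoo n))).
    rewrite /= lee_fin [leRHS]ger0_norm ?addr_ge0//.
    by rewrite -{1}[fine (u k.+1)](subKr (fine (un n k.+1))) ler_normB.
  apply: le_trans (seq_normD _ _); apply: seq_norm_le => k.
  by rewrite addeC subeK// seq_norm_fin.
- rewrite -[X in _ --> X]sube0; apply: cvgeB cv; [by rewrite fin_num_adde_defr|exact: cvg_cst].
- rewrite -[X in _ --> X]adde0; apply: cvgeD cv; [by rewrite fin_num_adde_defr|exact: cvg_cst].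
Qed.

Lemma seq_lattice : qBFL seq_mu seq_norm 1.
Proof.
split=> //.
- by move=> u _; exact: seq_norm_ge0.
- move=> u _; rewrite seq_ae; split=> [u0 n|u0].
    by apply/eqP; rewrite -abse_eq0 eq_le abse_ge0 andbT -u0 seq_norm_ge.
  by apply: eseries0 => n _ _; rewrite u0 abse0.
- move=> a u _; rewrite /seq_norm -nneseriesZl//; apply: eq_eseriesr => n _.
  by rewrite abseM.
split.
- by move=> u v _ _; rewrite mul1e seq_normD.
- by move=> u v _ _ /seq_ae; exact: seq_norm_le.
- move=> un _ un0.
  have un0' n k : (0 <= un n k.+1)%E by have /seq_ae := un0 n.
  under eq_eseriesr do rewrite expr1n mul1e.
  (* Tonelli for series of nonnegative terms. *)
  rewrite nneseries_interchange//; apply: lee_nneseries => // k _.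
  rewrite gee0_abs ?nneseries_ge0//; apply: lee_nneseries => // n _.
  exact: lee_abs.
- by move=> un u unX [_ uX]; apply: seq_norm_cvg => // n; case: (unX n).
Qed.

Lemma seq_norm0 : seq_norm (fun=> 0%E) = 0%E.
Proof. by apply: eseries0 => n _ _; rewrite abse0. Qed.

Lemma seq_N1norm u : N1norm (T := nat) seq_dist seq_norm u = seq_norm u.
Proof.
rewrite /N1norm; set i := ereal_inf _; suff -> : i = 0%E by rewrite adde0.
apply/eqP; rewrite eq_le; apply/andP; split; last first.
  by apply/ereal_infP => _ [g _ <-]; exact: seq_norm_ge0.
rewrite -seq_norm0; apply: ereal_inf_lbound; exists (fun=> 0%E) => //.
exact: ultrametric_upper_gradient0 seq_dist_metric seq_dist_ultra _.
Qed.

Lemma seq_inN1X u : (seq_norm u < +oo)%E -> inN1X (T := nat) seq_dist seq_norm u.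
Proof. by move=> uoo; split; [split|rewrite seq_N1norm]. Qed.

(** * Density of continuous functions and failure of (E) *)

Lemma seq_cont_dense : cont_dense (T := nat) seq_dist seq_norm.
Proof.
move=> u [[_ uoo] _] eps e0.
have tail := nneseries_tail_cvg uoo (fun k _ => abse_ge0 (u k.+1)).
have /tail[m _ /(_ m (leqnn m)) /= mtail] : nbhs (0%E : \bar R) [set y | (y < eps%:E)%E].
  by apply: open_nbhs_nbhs; split; [exact: open_ereal_lt_ereal|rewrite /= lte_fin].
(* The cut-off vanishes near 0 and all other points are isolated, so [v] is continuous; changing the
   value at 0 costs nothing in norm. *)
pose v x := if (0 < x <= m)%N then u x else 0%E.
have vf x : v x \is a fin_num.
  by rewrite /v; case: x => [|n]//=; case: ifP => // _; rewrite seq_norm_fin.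
exists v; split.
- apply: seq_inN1X; apply: le_lt_trans uoo; apply: seq_norm_le => n.
  by rewrite /v; case: ifP => // _; rewrite abse0.
- split=> // x _ e e1; case: x => [|x].
    exists m.+1%:R^-1; first by rewrite invr_gt0.
    move=> y _; rewrite /seq_dist; case: y => [|y] /=; first by rewrite subrr normr0.
    rewrite invr0 gt_max => /andP[_]; rewrite ltf_pV2 ?posrE// ltr_nat ltnS => ym.
    by rewrite /v /= ltnNge (ltnW ym) /= subrr normr0.
  exists x.+1%:R^-1; first by rewrite invr_gt0.
  move=> y _; rewrite /seq_dist; case: eqVneq => [->|_]; first by rewrite subrr normr0.
  by rewrite gt_max ltxx.
- rewrite seq_N1norm; apply: le_lt_trans mtail.
  rewrite /seq_norm (nneseries_split 0 m)// add0n big_nat big1 ?add0e => [|k /andP[_ km]].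
    apply: lee_nneseries => // k _; rewrite /v /=; case: ifP => _.
      by rewrite subee ?abse0// seq_norm_fin.
    by rewrite sube0.
  by rewrite /v /= km subee ?abse0// seq_norm_fin.
Qed.

(** The indicator of [{0}] has norm 0, so this set has capacity 0. A test function for a
    neighbourhood of 0 is at least 1 on a tail, which contradicts summability. *)
Lemma seq_not_propertyE : ~ propertyE (T := nat) seq_dist seq_norm.
Proof.
move=> /(_ [set 0%N]) H.
have cap0 : cap (T := nat) seq_dist seq_norm [set 0%N] = 0%E.
  pose u x := if x is 0%N then 1%E else 0%E : \bar R.
  have u0 : seq_norm u = 0%E by apply: eseries0 => n _ _; rewrite abse0.
  apply/eqP; rewrite eq_le; apply/andP; split.
    rewrite -u0 -seq_N1norm; apply: ereal_inf_lbound; exists u => //; split.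
      by apply: seq_inN1X; rewrite u0.
    by move=> _ ->.
  by apply/ereal_infP => _ [w _ <-]; rewrite seq_N1norm seq_norm_ge0.
have [G [oG G0 /ereal_inf_lt[_ [u [[[_ uoo] _] uG] _] _]]] := H cap0 1 ltr01.
have [r r0 rG] := oG 0%N (G0 _ erefl); have [n0 n0P] := seq_ball0 r0.
have tail := nneseries_tail_cvg uoo (fun k _ => abse_ge0 (u k.+1)).
have /tail[m _ /(_ (maxn m n0) (leq_maxl _ _)) /= mtail] :
    nbhs (0%E : \bar R) [set y | (y < 1)%E].
  by apply: open_nbhs_nbhs; split; [exact: open_ereal_lt_ereal|rewrite /= lte_fin].
move: mtail; rewrite ltNge => /negP; apply.
apply: (@le_trans _ _ `|u (maxn m n0).+1|%E).
  apply: le_trans (lee_abs _); apply: uG; apply: rG; apply: n0P.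
  by rewrite (leq_trans (leq_maxr m n0)).
apply: le_trans (nneseries_lim_ge (maxn m n0).+1 _) => //.
by rewrite big_nat1.
Qed.

End ConvergentSequence.

Theorem theorem1p6 :
  (forall (R : realType) (d0 : measure_display) (T : measurableType d0)
     (dist : T -> T -> R) (mu : {measure set T -> \bar R})
     (N : (T -> \bar R) -> \bar R) (c : R),
     standing_assumptions dist mu -> qBFL mu N c -> cont_dense dist N ->
     [/\ (propertyA dist N <-> propertyB dist N), (propertyA dist N <-> propertyC dist N),
         (propertyA dist N <-> propertyD dist N), (propertyA dist N <-> propertyE dist N) &
         propertyF dist N /\ propertyG dist N])
  /\
  (forall R : realType, exists (d0 : measure_display) (T : measurableType d0)
     (dist : T -> T -> R) (mu : {measure set T -> \bar R})
     (N : (T -> \bar R) -> \bar R),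
     [/\ standing_assumptions dist mu, metric_compact dist, qBFL mu N 1,
         cont_dense dist N &
         [/\ (~ propertyA dist N), (~ propertyB dist N), (~ propertyC dist N),
             (~ propertyD dist N) & (~ propertyE dist N)]]).
Proof.
have equiv (R : realType) (d0 : measure_display) (T : measurableType d0)
    (dist : T -> T -> R) (mu : {measure set T -> \bar R})
    (N : (T -> \bar R) -> \bar R) (c : R) :
  standing_assumptions dist mu -> qBFL mu N c -> cont_dense dist N ->
  [/\ (propertyA dist N <-> propertyB dist N), (propertyA dist N <-> propertyC dist N),
      (propertyA dist N <-> propertyD dist N), (propertyA dist N <-> propertyE dist N) &
      propertyF dist N /\ propertyG dist N].
  by move=> [dm om _ _] lat; exact: dense_properties_equivalent dm om lat.
split=> [//|R].
exists default_measure_display, nat, seq_dist, seq_mu, seq_norm.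
(* By the equivalence applied to this example, the failure of (E) refutes the other four
   properties. *)
have nE := @seq_not_propertyE R.
have [AB AC AD AE _] := equiv _ _ _ _ _ _ _ seq_standing seq_lattice (@seq_cont_dense R).
split; [exact: seq_standing|exact: seq_compact|exact: seq_lattice|exact: seq_cont_dense|].
by split; tauto.
Qed.
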